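(* Let $\mathscr{L}$ be the twisted Schrödinger-Virasoro Lie algebra over $\mathbb{C}$, and let $\mathcal{D}_1,\mathcal{D}_2,\mathcal{D}_3$ be the linear maps $\mathscr{L}\to\mathscr{L}$ defined for all $n\in\mathbb{Z}$ by $$\mathcal{D}_1(L_n)=M_n,\quad \mathcal{D}_1(M_n)=\mathcal{D}_1(Y_n)=\mathcal{D}_1(C)=0;$$ $$\mathcal{D}_2(L_n)=nM_n,\quad \mathcal{D}_2(M_n)=\mathcal{D}_2(Y_n)=\mathcal{D}_2(C)=0;$$ $$\mathcal{D}_3(Y_n)=Y_n,\quad \mathcal{D}_3(M_n)=2M_n,\quad \mathcal{D}_3(L_n)=\mathcal{D}_3(C)=0.$$ Then the derivation algebra of $\mathscr{L}$ is the direct sum of vector spaces $$\mathrm{Der}\,\mathscr{L}=\mathbb{C}\mathcal{D}_1\oplus\mathbb{C}\mathcal{D}_2\oplus\mathbb{C}\mathcal{D}_3\oplus\mathrm{ad}\,\mathscr{L}.$$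
   Context: The twisted Schrödinger-Virasoro Lie algebra $\mathscr{L}$ is the complex Lie algebra with basis $\{L_n,Y_n,M_n,C\mid n\in\mathbb{Z}\}$ and brackets, for all integers $n,n',m,m',p$: $[L_n,L_{n'}]=(n'-n)L_{n+n'}+\delta_{n,-n'}\frac{n^3-n}{12}C$; $[L_n,Y_m]=(m-\frac n2)Y_{n+m}$; $[L_n,M_p]=pM_{n+p}$; $[Y_m,Y_{m'}]=(m'-m)M_{m+m'}$; $[Y_m,M_p]=[M_n,M_p]=[\mathscr{L},C]=0$. $\mathrm{Der}\,\mathscr{L}$ is the space of all $\mathbb{C}$-linear derivations $\mathscr{L}\to\mathscr{L}$, and $\mathrm{ad}\,\mathscr{L}$ is the space of inner derivations $\mathrm{ad}\,x$, $x\in\mathscr{L}$. *)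

(* Defs.v *)
From HB Require Import structures.
From mathcomp Require Import all_boot all_order all_algebra complex finmap ring.
From mathcomp Require Import classical_sets functions reals.
From mathcomp Require Import monalg.

Set Implicit Arguments.
Unset Strict Implicit.
Unset Printing Implicit Defensive.

Import GRing.Theory Num.Theory.
Local Open Scope classical_set_scope.
Local Open Scope ring_scope.

HB.mixin Record Lmodule_isLieAlgebra (F : fieldType) L of GRing.Lmodule F L := {
  lie : L -> L -> L;
  lie_linearl : forall y, linear (lie^~ y);
  lie_linearr : forall x, linear (lie x);
  lie_alternating : forall x, lie x x = 0;
  lie_jacobi : forall x y z,
    lie x (lie y z) + lie y (lie z x) + lie z (lie x y) = 0
}.

#[short(type="lieAlgType")]
HB.structure Definition LieAlgebra (F : fieldType) :=
  { L of Lmodule_isLieAlgebra F L & GRing.Lmodule F L }.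

Section Derivations.
Variables (F : fieldType) (L : lieAlgType F).

Definition Der : set (L -> L) :=
  [set D | linear D /\
           forall x y : L, D (lie x y) = lie (D x) y + lie x (D y)].

Definition ad (x : L) : L -> L := fun y => lie x y.

Definition Inn : set (L -> L) := range ad.

End Derivations.

Arguments Der {F} L.
Arguments Inn {F} L.

Section DirectSum.
Variables (F : fieldType) (V : lmodType F).

Definition line (v : V) : set V := [set w | exists a : F, w = a *: v].

Definition is_subspace (U : set V) : Prop :=
  U 0 /\ forall (a : F) (u v : V), U u -> U v -> U (a *: u + v).

Definition direct_sum (W : set V) (Us : seq (set V)) : Prop :=
  let U (i : 'I_(size Us)) := nth set0 Us i in
  [/\ forall i, is_subspace (U i),
      W = [set w | exists2 u : 'I_(size Us) -> V,
                     forall i, U i (u i) & w = \sum_i u i]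
    & forall u : 'I_(size Us) -> V,
        (forall i, U i (u i)) -> \sum_i u i = 0 -> forall i, u i = 0].

End DirectSum.

Inductive sv_index : Type := iL of int | iY of int | iM of int | iC.

Definition sv_index_code (k : sv_index) : int + int + int + unit :=
  match k with
  | iL n => inl (inl (inl n))
  | iY n => inl (inl (inr n))
  | iM n => inl (inr n)
  | iC => inr tt
  end.

Definition sv_index_decode (c : int + int + int + unit) : sv_index :=
  match c with
  | inl (inl (inl n)) => iL n
  | inl (inl (inr n)) => iY n
  | inl (inr n) => iM n
  | inr _ => iC
  end.

Lemma sv_index_codeK : cancel sv_index_code sv_index_decode.
Proof. by case. Qed.

HB.instance Definition _ := Choice.copy sv_index (can_type sv_index_codeK).

Section LinearExtension.
Variables (K : choiceType) (F : fieldType) (V : lmodType F).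

(* The unique linear map sending the basis vector [<< k >>] to [phi k]. *)
Definition linext (phi : K -> V) (x : {malg F[K]}) : V :=
  \sum_(k <- msupp x) x@_k *: phi k.

Lemma linextw (d : {fset K}) phi x : (msupp x `<=` d)%fset ->
  linext phi x = \sum_(k <- d) x@_k *: phi k.
Proof.
move=> le; apply: big_fset_incl => // k _ /mcoeff_outdom ->.
by rewrite scale0r.
Qed.

Lemma linext_linear phi : linear (linext phi).
Proof.
move=> a x y; set d := (msupp x `|` msupp y)%fset.
have le : (msupp (a *: x + y) `<=` d)%fset.
  by apply: fsubset_trans (msuppD_le _ _) _; apply: fsetSU; apply: msuppZ_le.
rewrite (linextw _ le) (linextw _ (fsubsetUl _ (msupp y))).
rewrite (linextw _ (fsubsetUr (msupp x) _)) scaler_sumr -big_split /=.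
by apply: eq_bigr => k _; rewrite mcoeffD mcoeffZ scalerDl scalerA.
Qed.

HB.instance Definition _ phi :=
  GRing.isLinear.Build F {malg F[K]} V *:%R (linext phi) (linext_linear phi).

Lemma linextU phi k : linext phi << k >> = phi k.
Proof.
by rewrite (linextw _ msuppU_le) big_seq_fset1 mcoeffUU scale1r.
Qed.

Lemma malg_linear_ind (P : {malg F[K]} -> Prop) :
  (forall a x y, P x -> P y -> P (a *: x + y)) -> P 0 ->
  (forall k, P << k >>) -> forall x, P x.
Proof.
move=> PZ P0 PU x; rewrite [x]monalgE.
apply: big_rec => // k y _ Py.
suff -> : << x@_k *g k >> = x@_k *: (<< k >> : {malg F[K]}) by apply: PZ.
by apply/malgP => i; rewrite mcoeffZ !mcoeffU mulrnAr mulr1.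
Qed.

End LinearExtension.

Section Brackets.
Variables (F : numFieldType) (V : lmodType F).
Variables (L Y M : int -> V) (C : V).

Definition sv_basis_lie (j k : sv_index) : V :=
  match j, k with
  | iL n, iL n' => (n' - n)%:~R *: L (n + n')
      + ((n == - n')%:R * ((n ^+ 3 - n)%:~R / 12%:R)) *: C
  | iL n, iY m => (m%:~R - n%:~R / 2%:R) *: Y (n + m)
  | iY m, iL n => - ((m%:~R - n%:~R / 2%:R) *: Y (n + m))
  | iL n, iM p => p%:~R *: M (n + p)
  | iM p, iL n => - (p%:~R *: M (n + p))
  | iY m, iY m' => (m' - m)%:~R *: M (m + m')
  | _, _ => 0
  end.

Definition sv_basis (k : sv_index) : V :=
  match k with iL n => L n | iY n => Y n | iM n => M n | iC => C end.

Lemma sv_basis_lie_jacobi (lie : V -> V -> V) :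
  (forall u v w, lie u (v + w) = lie u v + lie u w) ->
  (forall a u v, lie u (a *: v) = a *: lie u v) ->
  (forall j k, lie (sv_basis j) (sv_basis k) = sv_basis_lie j k) ->
  forall i j k, lie (sv_basis i) (sv_basis_lie j k)
    + lie (sv_basis j) (sv_basis_lie k i)
    + lie (sv_basis k) (sv_basis_lie i j) = 0.
Proof.
rewrite /sv_basis_lie /sv_basis.
move: (12%:R^-1 : F) => h lieD lieZ H i j k.
have lie0 u : lie u 0 = 0 by have := lieZ 0 u 0; rewrite !scale0r.
have lieN u v : lie u (- v) = - lie u v by rewrite -scaleN1r lieZ scaleN1r.
have HLL m n := H (iL m) (iL n). have HLY m n := H (iL m) (iY n).
have HLM m n := H (iL m) (iM n). have HLC m := H (iL m) iC.
have HYL m n := H (iY m) (iL n). have HYY m n := H (iY m) (iY n).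
have HYM m n := H (iY m) (iM n). have HYC m := H (iY m) iC.
have HML m n := H (iM m) (iL n). have HMY m n := H (iM m) (iY n).
have HMM m n := H (iM m) (iM n). have HMC m := H (iM m) iC.
have HCL n := H iC (iL n). have HCY n := H iC (iY n).
have HCM n := H iC (iM n). have HCC := H iC iC.
have E := (HLL, HLY, HLM, HLC, HYL, HYY, HYM, HYC,
  HML, HMY, HMM, HMC, HCL, HCY, HCM, HCC).
rewrite /= in E.
clear HLL HLY HLM HLC HYL HYY HYM HYC HML HMY HMM HMC HCL HCY HCM HCC.
case: i j k => [a|a|a|] [b|b|b|] [c|c|c|]; cbv beta iota.
all: rewrite ?(lieD, lieN, lieZ, lie0, E) ?(scaler0, oppr0, addr0, add0r).
all: try match goal with |- 0 = 0 => reflexivity end.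
all: have e1 : b + (a + c) = a + (b + c) by ring.
all: have e2 : a + (c + b) = a + (b + c) by ring.
all: have e3 : b + (c + a) = a + (b + c) by ring.
all: have e4 : c + (a + b) = a + (b + c) by ring.
all: have e5 : c + (b + a) = a + (b + c) by ring.
all: have e6 : a + b + c = a + (b + c) by ring.
all: have e7 : c + a + b = a + (b + c) by ring.
all: have e8 : b + c + a = a + (b + c) by ring.
all: rewrite ?(e1, e2, e3, e4, e5, e6, e7, e8) ?scalerN ?opprK.
all: rewrite ?scalerDr ?scalerA -?scaleNr -?scalerDl.
all: try by rewrite [X in X *: _](_ : _ = 0) ?scale0r //; field.
rewrite (addrACA (_ *: L _)) (addrACA (_ *: L _ + _)) -!scalerDl.
rewrite [X in X *: L _](_ : _ = 0) ?scale0r ?add0r; last by ring.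
rewrite [X in X *: _](_ : _ = 0) ?scale0r //.
have [E1 E2 E3] : [/\ (a == - (b + c)) = (a + b + c == 0),
    (b == - (c + a)) = (a + b + c == 0) & (c == - (a + b)) = (a + b + c == 0)].
  by rewrite -!addr_eq0; split; congr (_ == _); ring.
rewrite E1 E2 E3; have [s0|_] := eqVneq (a + b + c) 0; last first.
  by rewrite !mul0r !mulr0 !addr0.
have -> : c = - (a + b) by apply/eqP; rewrite E3 s0.
by ring.
Qed.

End Brackets.

Section SchrodingerVirasoro.
Variable F : numFieldType.

(* [<< k >>], for k : sv_index, is the basis of the space of finitely
   supported functions [sv_index -> F]. *)
Definition sv : Type := {malg F[sv_index]}.
HB.instance Definition _ := GRing.Lmodule.on sv.

Definition svL (n : int) : sv := << iL n >>.
Definition svY (n : int) : sv := << iY n >>.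
Definition svM (n : int) : sv := << iM n >>.
Definition svC : sv := << iC >>.

Local Notation table := (sv_basis_lie svL svY svM svC).

Definition sv_lie (x y : sv) : sv :=
  linext (fun j => linext (table j) y) x.

Lemma sv_lie_linearl y : linear (sv_lie^~ y).
Proof. exact: linext_linear. Qed.

Lemma sv_lie_linearr x : linear (sv_lie x).
Proof.
move=> a y z; rewrite /sv_lie /linext.
rewrite scaler_sumr -big_split /=; apply: eq_bigr => k _.
by rewrite -!/(linext _ _) linearP scalerDr !scalerA mulrC.
Qed.

HB.instance Definition _ x :=
  GRing.isLinear.Build F sv sv *:%R (sv_lie x) (sv_lie_linearr x).

Lemma sv_lie0r x : sv_lie x 0 = 0.
Proof. exact: linear0. Qed.

Lemma sv_lieUU j k : sv_lie << j >> << k >> = table j k.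
Proof. by rewrite /sv_lie !linextU. Qed.

Lemma sv_lieDl y a x x' :
  sv_lie (a *: x + x') y = a *: sv_lie x y + sv_lie x' y.
Proof. exact: sv_lie_linearl. Qed.

Lemma sv_lie0l y : sv_lie 0 y = 0.
Proof. by rewrite /sv_lie linear0. Qed.

Lemma sv_lie_anti x y : sv_lie x y = - sv_lie y x.
Proof.
elim/malg_linear_ind: x => [a x x' IHx IHx'||j].
- by rewrite sv_lieDl sv_lie_linearr IHx IHx' opprD scalerN.
- by rewrite sv_lie0l sv_lie0r oppr0.
elim/malg_linear_ind: y => [a y y' IHy IHy'||k].
- by rewrite sv_lieDl sv_lie_linearr IHy IHy' opprD scalerN.
- by rewrite sv_lie0l sv_lie0r oppr0.
rewrite !sv_lieUU; case: j k => [n|n|n|] [m|m|m|] //=; rewrite ?opprK ?oppr0 //.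
- rewrite opprD -!scaleNr [m + n]addrC -rmorphN opprB.
  congr (_ + _); congr (_ *: _); have [->|neq] := eqVneq n (- m); last first.
    by rewrite -eqr_oppLR eq_sym (negbTE neq) !mul0r oppr0.
  rewrite opprK eqxx -mulrN -mulNr -rmorphN; congr (_ * (_%:~R / _)); ring.
- by rewrite -scaleNr -rmorphN opprB [m + n]addrC.
Qed.

Lemma sv_lie_alternating x : sv_lie x x = 0.
Proof.
have /eqP := sv_lie_anti x x; rewrite -subr_eq0 opprK -mulr2n -scaler_nat.
by rewrite scaler_eq0 pnatr_eq0 /= => /eqP.
Qed.

Lemma sv_lie_jacobi x y z :
  sv_lie x (sv_lie y z) + sv_lie y (sv_lie z x) + sv_lie z (sv_lie x y) = 0.
Proof.
have comb a (u u' v v' w w' : sv) : u + v + w = 0 -> u' + v' + w' = 0 ->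
  (a *: u + u') + (a *: v + v') + (a *: w + w') = 0.
  move=> e e'; transitivity (a *: (u + v + w) + (u' + v' + w')).
    by rewrite !scalerDr (addrACA (a *: u)) (addrACA (a *: u + _)).
  by rewrite e e' scaler0 addr0.
elim/malg_linear_ind: x => [a x x' IHx IHx'||i].
- by rewrite sv_lieDl !sv_lie_linearr !sv_lieDl !sv_lie_linearr; apply: comb.
- by rewrite !(sv_lie0l, sv_lie0r, addr0).
elim/malg_linear_ind: y => [a y y' IHy IHy'||j].
- by rewrite !sv_lieDl !sv_lie_linearr ?sv_lieDl; apply: comb.
- by rewrite !(sv_lie0l, sv_lie0r, addr0).
elim/malg_linear_ind: z => [a z z' IHz IHz'||k].
- by rewrite !sv_lieDl !sv_lie_linearr ?sv_lieDl; apply: comb.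
- by rewrite !(sv_lie0l, sv_lie0r, addr0).
have lieD u v w : sv_lie u (v + w) = sv_lie u v + sv_lie u w by exact: linearD.
have lieZ a u v : sv_lie u (a *: v) = a *: sv_lie u v by exact: linearZ.
pose e := sv_basis svL svY svM svC.
have eE l : << l >> = e l :> sv by case: l.
have H l m : sv_lie (e l) (e m) = table l m by rewrite -!eE sv_lieUU.
by rewrite !sv_lieUU !eE; apply: sv_basis_lie_jacobi.
Qed.

HB.instance Definition _ := Lmodule_isLieAlgebra.Build F sv
  sv_lie_linearl sv_lie_linearr sv_lie_alternating sv_lie_jacobi.

Lemma lie_svLL n n' : lie (svL n) (svL n') = (n' - n)%:~R *: svL (n + n')
  + ((n == - n')%:R * ((n ^+ 3 - n)%:~R / 12%:R)) *: svC.
Proof. exact: sv_lieUU. Qed.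

Lemma lie_svLY n m :
  lie (svL n) (svY m) = (m%:~R - n%:~R / 2%:R) *: svY (n + m).
Proof. exact: sv_lieUU. Qed.

Lemma lie_svLM n p : lie (svL n) (svM p) = p%:~R *: svM (n + p).
Proof. exact: sv_lieUU. Qed.

Lemma lie_svYY m m' : lie (svY m) (svY m') = (m' - m)%:~R *: svM (m + m').
Proof. exact: sv_lieUU. Qed.

Lemma lie_svYM m p : lie (svY m) (svM p) = 0.
Proof. exact: sv_lieUU. Qed.

Lemma lie_svMM n p : lie (svM n) (svM p) = 0.
Proof. exact: sv_lieUU. Qed.

Lemma lie_svC (x : sv) : lie x svC = 0.
Proof.
change (sv_lie x svC = 0); elim/malg_linear_ind: x => [a x y hx hy||k].
- by rewrite sv_lieDl hx hy scaler0 addr0.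
- exact: sv_lie0l.
- by rewrite sv_lieUU; case: k.
Qed.

Definition svD1 : sv -> sv :=
  linext (fun k => if k is iL n then svM n else 0).

Definition svD2 : sv -> sv :=
  linext (fun k => if k is iL n then n%:~R *: svM n else 0).

Definition svD3 : sv -> sv :=
  linext (fun k => match k with
                   | iY n => svY n
                   | iM n => 2%:R *: svM n
                   | iL _ | iC => 0
                   end).

End SchrodingerVirasoro.

Arguments svD1 {F}.
Arguments svD2 {F}.
Arguments svD3 {F}.

(* Main.v *)
Require Import Defs.
From mathcomp Require Import all_boot all_order all_algebra complex.
From mathcomp Require Import classical_sets functions reals.
From HB Require Import structures.
From mathcomp Require Import boolp monalg ring.

Set Implicit Arguments.
Unset Strict Implicit.
Unset Printing Implicit Defensive.

Import GRing.Theory Num.Theory.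
Local Open Scope ring_scope.

(** The idea is to measure a derivation D by three scalars: the coefficient of
M_0 in D L_0, that of M_1 in D L_1 and that of Y_0 in D Y_0.  All three vanish
on inner derivations ([der_coef_ad]), because M_0 is central and L_0
commutes with Y_0.  On D_1, D_2, D_3 they take the values (1, 1, 0), (0, 1, 0), (0, 0, 1), an invertible
table.  Hence the sum of the three lines and the inner derivations is direct,
and any derivation becomes, after subtraction of a unique combination of
D_1, D_2, D_3, one on which the three scalars vanish.  It remains to see that
such a derivation D is inner ([der_coef0_Inn]).

Subtracting an inner derivation, one may remove from D L_0 all the components
of nonzero degree, since ad L_0 is invertible on them ([deg0_split]).  Then
D L_0 = p L_0 + q Y_0 + r C, the component on M_0 being one of the three
scalars.  Applying D to [L_0, L_1] = L_1 and comparing the components of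
degree 1 gives p = q = 0, so D L_0 is central; hence D commutes with ad L_0
and preserves the degree ([der_homogeneous]).  This settles at once the
question of infinitely many homogeneous components: there is only one.

Now D L_1 = p L_1 + q Y_1, which is the value at L_1 of the inner derivation
by p L_0 + 2 q Y_0; this one also kills L_0, so it can be subtracted.
We are left with a degree-preserving D that kills L_1, with D L_0 in the line
of C and no component of Y_0 in D Y_0.  Such a D is 0 ([der_eq0]): in
the degrees -1, 2, -2 bracketing with a suitable L_1 or L_(-1) is injective,
which gives D L_(-1) = D L_2 = D L_(-2) = 0, and these elements with L_1
generate all the L_n and C; a relation in degree 2 kills the L_0 component of
D Y_0; finally the Y_n come from Y_0 and the M_n from the Y_n.

The argument uses only the bracket table, so it is carried out in an arbitrary
Lie algebra with a basis that multiplies by this table. *)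

(** * Lie algebras and their derivations *)

Section LieAlgebra.
Context {F : fieldType} {L : lieAlgType F}.
Implicit Types (x y z : L) (D E : L -> L).

HB.instance Definition _ x :=
  GRing.isLinear.Build F L L *:%R (lie x) (lie_linearr x).

Lemma lieDl x x' y : lie (x + x') y = lie x y + lie x' y.
Proof. by have := lie_linearl y 1 x x'; rewrite !scale1r. Qed.

Lemma lie0l y : lie (0 : L) y = 0.
Proof. by apply: (addIr (lie 0 y)); rewrite -lieDl !add0r. Qed.

Lemma lieZl a x y : lie (a *: x) y = a *: lie x y.
Proof. by have := lie_linearl y a x 0; rewrite !addr0 lie0l addr0. Qed.

Lemma lie_anti x y : lie x y = - lie y x.
Proof.
apply/eqP; rewrite -addr_eq0; have := lie_alternating (x + y).
by rewrite lieDl !linearD /= !lie_alternating add0r addr0 => ->.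
Qed.

Lemma ad_Der x : Der L (ad x).
Proof.
split; first exact: lie_linearr.
move=> y z; rewrite /ad [lie (lie x y) z]lie_anti [lie x z]lie_anti linearN /=.
by apply/eqP; rewrite -opprD -addr_eq0 [_ + lie y _]addrC addrA lie_jacobi.
Qed.

Lemma Inn_subspace : is_subspace (Inn L).
Proof.
split; first by exists 0 => //; apply/funext => y; rewrite /ad lie0l.
move=> a _ _ [x _ <-] [y _ <-]; exists (a *: x + y) => //.
by apply/funext => z; rewrite /ad lieDl lieZl.
Qed.

Lemma Der_subspace : is_subspace (Der L).
Proof.
split.
  split; first by move=> a x y; rewrite /= scaler0 addr0.
  by move=> x y; rewrite /= lie0l linear0 addr0.
move=> a D E [linD derD] [linE derE]; split.
  by move=> b x y; rewrite !fctE linD linE !scalerDr !scalerA addrACA [a * b]mulrC.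
move=> x y; rewrite !fctE derD derE lieDl lieZl (lie_linearr x).
by rewrite scalerDr addrACA.
Qed.

Lemma derZ D (DD : Der L D) a x : D (a *: x) = a *: D x.
Proof.
case: DD => linD _; have D0 : D 0 = 0.
  by apply: (addIr (D 0)); rewrite -[X in X + _]scale1r -linD scaler0 !add0r.
by have := linD a x 0; rewrite !addr0 D0 addr0.
Qed.

Lemma derD D (DD : Der L D) x y : D (x + y) = D x + D y.
Proof. by case: DD => linD _; have := linD 1 x y; rewrite !scale1r. Qed.

Lemma der_sub D E : Der L D -> Der L E -> Der L (D - E).
Proof.
by move=> DD DE; rewrite addrC -scaleN1r; apply: Der_subspace.2.
Qed.

End LieAlgebra.

(** * Direct sums of four subspaces *)

Section DirectSum.
Context {F : fieldType} {V : lmodType F}.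

Lemma line_subspace (v : V) : is_subspace (line v).
Proof.
split; first by exists 0; rewrite scale0r.
by move=> a _ _ [c ->] [d ->]; exists (a * c + d); rewrite scalerDl scalerA.
Qed.

Lemma direct_sum4 (W U1 U2 U3 U4 : set V) :
  is_subspace U1 -> is_subspace U2 -> is_subspace U3 -> is_subspace U4 ->
  (forall w, W w <-> exists u1 u2 u3 u4,
     [/\ U1 u1, U2 u2, U3 u3, U4 u4 & w = u1 + u2 + u3 + u4]) ->
  (forall u1 u2 u3 u4, U1 u1 -> U2 u2 -> U3 u3 -> U4 u4 ->
     u1 + u2 + u3 + u4 = 0 -> [/\ u1 = 0, u2 = 0, u3 = 0 & u4 = 0]) ->
  direct_sum W [:: U1; U2; U3; U4].
Proof.
move=> S1 S2 S3 S4 WE indep.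
pose i0 : 'I_4 := @Ordinal 4 0 isT; pose i1 : 'I_4 := @Ordinal 4 1 isT.
pose i2 : 'I_4 := @Ordinal 4 2 isT; pose i3 : 'I_4 := @Ordinal 4 3 isT.
have sum4 (u : 'I_4 -> V) : \sum_i u i = u i0 + u i1 + u i2 + u i3.
  rewrite 4!big_ord_recl big_ord0 addr0 !addrA.
  by do ![congr (_ + _)]; congr u; apply: val_inj.
split.
- by case=> [[|[|[|[|]]]]].
- apply/funext => w; apply/propext; rewrite (WE w) /=; split.
    move=> [u1 [u2 [u3 [u4 [h1 h2 h3 h4 ->]]]]].
    exists (fun i : 'I_4 => nth 0 [:: u1; u2; u3; u4] i); last by rewrite sum4.
    by case=> [[|[|[|[|]]]]].
  move=> [u hu ->]; rewrite sum4; exists (u i0), (u i1), (u i2), (u i3).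
  by split; [exact: (hu i0)|exact: (hu i1)|exact: (hu i2)|exact: (hu i3)|].
move=> u hu; rewrite sum4 => eq0.
have [e0 e1 e2 e3] := indep _ _ _ _ (hu i0) (hu i1) (hu i2) (hu i3) eq0.
by case=> [[|[|[|[|]]]] hi] //; [rewrite -e0|rewrite -e1|rewrite -e2|rewrite -e3];
  congr u; apply: val_inj.
Qed.

End DirectSum.

(** * Lie algebras with the bracket table of the Schrodinger-Virasoro algebra *)

(** [b] is a basis with dual coordinate forms [coef]; that it is a basis enters
through [coef_inj], coordinates separate vectors, and [b_ind], an induction
principle expressing that the basis spans. *)
Section SchrodingerVirasoroBasis.
Context {F : numFieldType} {V : lieAlgType F} (b : sv_index -> V)
  (coef : sv_index -> {scalar V}).
Local Notation bL n := (b (iL n)).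
Local Notation bY n := (b (iY n)).
Local Notation bM n := (b (iM n)).
Local Notation bC := (b iC).
Context
  (lie_b : forall k l, lie (b k) (b l) = sv_basis_lie (fun n => bL n)
     (fun n => bY n) (fun n => bM n) bC k l)
  (coef_b : forall k l, coef k (b l) = (l == k)%:R)
  (coef_inj : forall x y, (forall k, coef k x = coef k y) -> x = y)
  (b_ind : forall P : V -> Prop, (forall a x y, P x -> P y -> P (a *: x + y)) ->
     P 0 -> (forall k, P (b k)) -> forall x, P x).
Implicit Types (x y z : V) (k l : sv_index) (n m : int) (D : V -> V).

(** ** Bracket table and degree *)

Lemma sv_index_eqE : (forall n m, (iL n == iL m) = (n == m)) *
  (forall n m, (iY n == iY m) = (n == m)) *
  (forall n m, (iM n == iM m) = (n == m)) *
  ((forall n m, (iL n == iY m) = false) * (forall n m, (iL n == iM m) = false) *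
   (forall n, (iL n == iC) = false) * (forall n m, (iY n == iL m) = false) *
   (forall n m, (iY n == iM m) = false) * (forall n, (iY n == iC) = false) *
   (forall n m, (iM n == iL m) = false) * (forall n m, (iM n == iY m) = false) *
   (forall n, (iM n == iC) = false) * (forall n, (iC == iL n) = false) *
   (forall n, (iC == iY n) = false) * (forall n, (iC == iM n) = false)).
Proof. by do !split=> *; apply/eqP/eqP => [[]|->]. Qed.

Lemma coefE : (forall k x y, coef k (x + y) = coef k x + coef k y) *
  (forall k a x, coef k (a *: x) = a * coef k x) *
  (forall k x, coef k (- x) = - coef k x) * (forall k, coef k 0 = 0).
Proof.
do !split=> *; by [exact: linearD|exact: linearZ|exact: linearN|exact: linear0].
Qed.

Lemma lie_bLL n m : lie (bL n) (bL m) = (m - n)%:~R *: bL (n + m)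
  + ((n == - m)%:R * ((n ^+ 3 - n)%:~R / 12%:R)) *: bC.
Proof. exact: lie_b. Qed.

Lemma lie_bLY n m :
  lie (bL n) (bY m) = (m%:~R - n%:~R / 2%:R) *: bY (n + m).
Proof. exact: lie_b. Qed.

Lemma lie_bLM n m : lie (bL n) (bM m) = m%:~R *: bM (n + m).
Proof. exact: lie_b. Qed.

Lemma lie_bYY n m : lie (bY n) (bY m) = (m - n)%:~R *: bM (n + m).
Proof. exact: lie_b. Qed.

Lemma lie_bC x : lie x bC = 0.
Proof.
elim/b_ind: x => [a x y ex ey||k]; last by rewrite lie_b; case: k.
  by rewrite lieDl lieZl ex ey scaler0 addr0.
exact: lie0l.
Qed.

Definition deg k : int :=
  match k with iL n | iY n | iM n => n | iC => 0 end.

Lemma lie_L0b k : lie (bL 0) (b k) = (deg k)%:~R *: b k.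
Proof.
rewrite lie_b; case: k => [n|n|n|] /=.
- by rewrite subr0 add0r expr0n subr0 mul0r mulr0 scale0r addr0.
- by rewrite mul0r subr0 add0r.
- by rewrite add0r.
by rewrite scale0r.
Qed.

Lemma coef_lie_L0 k x :
  coef k (lie (bL 0) x) = (deg k)%:~R * coef k x.
Proof.
elim/b_ind: x => [a x y ex ey||l].
- by rewrite lie_linearr !coefE ex ey mulrDr mulrCA.
- by rewrite linear0 !coefE mulr0.
rewrite lie_L0b coefE coef_b; case: eqP => [->//|_].
by rewrite !mulr0.
Qed.

(** Being of degree [n] is phrased as an eigenvector equation for [ad L_0]; in
this form it passes through any derivation that sends [L_0] into the centre. *)
Definition homogeneous n x := lie (bL 0) x = n%:~R *: x.

Lemma homogeneousb k : homogeneous (deg k) (b k).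
Proof. exact: lie_L0b. Qed.

Lemma coef_homogeneous n x k :
  homogeneous n x -> deg k != n -> coef k x = 0.
Proof.
move=> hx kn; have := coef_lie_L0 k x; rewrite hx linearZ /= => /eqP.
rewrite -subr_eq0 -mulrBl mulf_eq0 -rmorphB intr_eq0 subr_eq0 eq_sym.
by rewrite (negPf kn) => /eqP.
Qed.

Lemma homogeneousE n x : homogeneous n x ->
  x = coef (iL n) x *: bL n + coef (iY n) x *: bY n
      + coef (iM n) x *: bM n + coef iC x *: bC.
Proof.
move=> hx; apply: coef_inj => k; have x0 k := coef_homogeneous (k := k) hx.
case: k => [m|m|m|]; rewrite !coefE !coef_b !sv_index_eqE ?eqxx.
all: rewrite ?(mulr0, addr0, add0r, mulr1) //.
all: have [->|nm] := eqVneq n m; rewrite ?mulr1 // mulr0 x0 //= eq_sym.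
all: exact: nm.
Qed.

Lemma homogeneous_neq0E n x : n != 0 -> homogeneous n x ->
  x = coef (iL n) x *: bL n + coef (iY n) x *: bY n
      + coef (iM n) x *: bM n.
Proof.
move=> n0 hx; rewrite {1}(homogeneousE hx).
by rewrite (coef_homogeneous (k := iC) hx) ?scale0r ?addr0 //= eq_sym.
Qed.

(** On degree [n], [ad L_m] multiplies the [L], [Y] and [M] coordinates by
[n - m], [n - m / 2] and [n]; the three side conditions say that none of these
is zero, and the first one also excludes a [C] coordinate. *)
Lemma homogeneous_lieL_eq0 m n x c : homogeneous n x ->
  n != 0 -> n != m -> n *+ 2 != m -> lie (bL m) x = c *: bC -> x = 0.
Proof.
move=> hx n0 nm n2; have := homogeneous_neq0E n0 hx.
move: (coef _ x) (coef _ x) (coef _ x) => p q r ->.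
rewrite !linearD !linearZ /= lie_bLL lie_bLY lie_bLM => e.
have e_ k := congr1 (coef k) e.
have n2R : n%:~R - m%:~R / 2%:R != 0 :> F.
  apply: contra_neq n2 => /eqP; rewrite subr_eq0 => /eqP e2.
  by apply: (@intr_inj F); rewrite -mulr_natr rmorphM /= e2; field.
move: (e_ (iL (m + n))) (e_ (iY (m + n))) (e_ (iM (m + n))).
rewrite !coefE !coef_b !sv_index_eqE !eqxx !(mulr0, addr0, add0r, mulr1).
move=> /eqP + /eqP + /eqP; rewrite !mulf_eq0 (negPf n2R) !intr_eq0 subr_eq0.
rewrite (negPf n0) (negPf nm) !orbF.
by move=> /eqP-> /eqP-> /eqP->; rewrite !scale0r !addr0.
Qed.

(** As [C] is central, [D] commutes with [ad L_0], so it preserves its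
eigenspaces. *)
Lemma der_homogeneous D d n x : Der V D -> D (bL 0) = d *: bC ->
  homogeneous n x -> homogeneous n (D x).
Proof.
move=> DD D0 hx; rewrite /homogeneous -(derZ DD) -hx (proj2 DD) D0 lieZl.
by rewrite [lie bC x]lie_anti lie_bC oppr0 scaler0 add0r.
Qed.

(** ** The derivations with three vanishing coefficients *)

Definition der_coef k l D : F := coef k (D (b l)).

Lemma der_coef_linear k l : scalar (der_coef k l).
Proof. by move=> a D E; rewrite /der_coef !fctE linearP. Qed.

HB.instance Definition _ k l :=
  GRing.isLinear.Build F (V -> V) F *%R (der_coef k l) (der_coef_linear k l).

(** For [s = 1] and [s = -1] the cocycle [s ^ 3 - s] vanishes, so the bracket
with [L_s] has no component on [C]. *)
Lemma lie_bLL1 s n : s ^+ 2 = 1 ->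
  lie (bL s) (bL n) = (n - s)%:~R *: bL (s + n).
Proof.
move=> s1; rewrite lie_bLL [s ^+ 3]exprS s1 mulr1 subrr mul0r mulr0 scale0r.
by rewrite addr0.
Qed.

(** [L_s] and [L_(2 s)] generate every [L_(s n)] with [n > 0], by repeated
brackets with [L_s]; starting from [L_s] alone the first step would be
[[L_s, L_s] = 0]. *)
Lemma der_ray_eq0 D s : Der V D -> s ^+ 2 = 1 -> D (bL 0) = 0 ->
  D (bL s) = 0 -> D (bL (s * 2)) = 0 ->
  forall n : nat, D (bL (s * n%:Z)) = 0.
Proof.
move=> DD s1 D0 Ds D2; elim=> [|[|[|n]] IHn]; rewrite ?mulr0 ?mulr1 //.
have := DD.2 (bL s) (bL (s * n.+2%:Z)).
rewrite Ds IHn lie0l linear0 addr0 lie_bLL1 // (derZ DD) => /eqP.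
rewrite scaler_eq0 intr_eq0 -{2}[s]mulr1 -mulrBr mulf_eq0.
have -> : s == 0 = false by apply/eqP => s0; rewrite s0 expr0n in s1.
have -> : n.+2%:Z - 1 == 0 = false by rewrite subr_eq0.
by rewrite -{1}[s]mulr1 -mulrDr => /eqP.
Qed.

(** [L_(-1)], [L_2] and [L_(-2)] are mapped by one of [ad L_1], [ad L_(-1)] to a
multiple of [L_0], [L_1] or [L_(-1)], and that bracket is injective in their
degree; so [D] kills them one after the other. *)
Lemma der_L_eq0 D d : Der V D -> D (bL 0) = d *: bC -> D (bL 1) = 0 ->
  forall n, D (bL n) = 0.
Proof.
move=> DD D0 D1.
have hom k := der_homogeneous DD D0 (homogeneousb k).
have DLL n m : D (lie (bL n) (bL m)) =
    lie (D (bL n)) (bL m) + lie (bL n) (D (bL m)) by exact: DD.2.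
have lieL1 n : lie (bL 1) (D (bL n)) = (n - 1)%:~R *: D (bL (1 + n)).
  by rewrite -(derZ DD) -lie_bLL1 // DLL D1 lie0l add0r.
have DN1 : D (bL (-1)) = 0.
  apply: (@homogeneous_lieL_eq0 1 (-1) _ (-2 * d)) => //; first exact: (hom (iL (-1))).
  by rewrite lieL1 addrN D0 scalerA.
(* Now that [D L_(-1) = 0], the same bracket [[L_1, L_(-1)] = -2 L_0] is used
   backwards. *)
have d0 : D (bL 0) = 0.
  have := lieL1 (-1); rewrite DN1 linear0 addrN => /esym/eqP.
  by rewrite scaler_eq0 intr_eq0 => /eqP.
have lieLN1 n : lie (bL (-1)) (D (bL n)) = (n + 1)%:~R *: D (bL (n - 1)).
  rewrite -[n + 1]/(n - - 1) [n - 1]addrC -(derZ DD) -lie_bLL1 // DLL DN1.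
  by rewrite lie0l add0r.
have D2 : D (bL 2) = 0.
  apply: (@homogeneous_lieL_eq0 (-1) 2 _ 0) => //; first exact: (hom (iL 2)).
  by rewrite lieLN1 [bL _](_ : _ = bL 1) // D1 scaler0 scale0r.
have DN2 : D (bL (-2)) = 0.
  apply: (@homogeneous_lieL_eq0 1 (-2) _ 0) => //; first exact: (hom (iL (-2))).
  by rewrite lieL1 [bL _](_ : _ = bL (-1)) // DN1 scaler0 scale0r.
case/intP => [//|m|m]; first by rewrite -[_%:Z]mul1r; apply: der_ray_eq0.
by rewrite -mulN1r; apply: der_ray_eq0.
Qed.

(** Since [[L_n, Y_0] = - n / 2 Y_n], the [Y_n] with [n <> 0] are determined by
[D Y_0 = e L_0 + g M_0 + h C], and come out as [2 e L_n].  Applying [D] to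
[[L_1, Y_1] = Y_2 / 2] then forces [e = 0], and [Y_0] itself is recovered from
[[L_1, Y_(-1)]]. *)
Lemma der_Y_eq0 D : Der V D -> (forall n, D (bL n) = 0) ->
  der_coef (iY 0) (iY 0) D = 0 -> forall n, D (bY n) = 0.
Proof.
move=> DD DL DY.
have D0 : D (bL 0) = 0 *: bC by rewrite DL scale0r.
have DLr n z : D (lie (bL n) z) = lie (bL n) (D z).
  by rewrite DD.2 DL lie0l add0r.
have DYn n : n != 0 -> (- n%:~R / 2%:R) *: D (bY n) = lie (bL n) (D (bY 0)).
  by move=> n0; rewrite -DLr lie_bLY (derZ DD) sub0r addr0 mulNr.
have hY := homogeneousE (der_homogeneous DD D0 (homogeneousb (iY 0))); rewrite /= in hY.
have DY00 : coef (iY 0) (D (bY 0)) = 0 by [].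
rewrite DY00 scale0r addr0 in hY.
set e := coef (iL 0) _ in hY.
have lieY n : n != 0 -> lie (bL n) (D (bY 0)) = - (n%:~R * e) *: bL n.
  move=> n0; rewrite hY !linearD !linearZ /= lie_bLL lie_bLM lie_bC.
  rewrite scale0r !scaler0 !addr0 oppr0 (negPf n0) mul0r scale0r addr0 sub0r scalerA.
  by rewrite rmorphN mulrN mulrC.
have DYnE n : n != 0 -> D (bY n) = (2%:R * e) *: bL n.
  move=> n0; have nR : n%:~R != 0 :> F by rewrite intr_eq0.
  have q0 : - n%:~R / 2%:R != 0 :> F by rewrite mulf_neq0 ?oppr_eq0 ?invr_eq0 ?pnatr_eq0.
  apply: (scalerI q0); rewrite DYn // lieY // scalerA; congr (_ *: _); by field.
have e0 : e = 0.
  have := DLr 1 (bY 1); rewrite DYnE // linearZ /= lie_alternating scaler0.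
  rewrite lie_bLY (derZ DD) DYnE // scalerA => /eqP.
  rewrite scaler_eq0 => /orP[|/eqP/(congr1 (coef (iL 2)))]; last first.
    by rewrite coef_b linear0 eqxx => /eqP; rewrite oner_eq0.
  rewrite [X in X == 0](_ : _ = e); first by move/eqP.
  by field.
move=> n; have [->|/DYnE->] := eqVneq n 0; last by rewrite e0 mulr0 scale0r.
have := DLr 1 (bY (-1)); rewrite DYnE // e0 mulr0 scale0r linear0.
rewrite lie_bLY addrN (derZ DD) => /eqP; rewrite scaler_eq0 => /orP[|/eqP//].
rewrite [X in X == 0](_ : _ = - (3%:R / 2%:R)); last by field.
by rewrite oppr_eq0 mulf_eq0 invr_eq0 !pnatr_eq0.
Qed.

Lemma der_eq0 D d : Der V D -> D (bL 0) = d *: bC -> D (bL 1) = 0 ->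
  der_coef (iY 0) (iY 0) D = 0 -> D = 0.
Proof.
move=> DD D0 D1 DY.
have DL := der_L_eq0 DD D0 D1.
have DYE := der_Y_eq0 DD DL DY.
have i12 : (12%:R^-1 == 0 :> F) = false by rewrite invr_eq0 pnatr_eq0.
have DC : D bC = 0.
  (* [C] occurs in [[L_2, L_(-2)] = -4 L_0 + C / 2]. *)
  have := DD.2 (bL 2) (bL (-2)); rewrite !DL lie0l linear0 addr0 lie_bLL.
  rewrite (derD DD) !(derZ DD) DL scaler0 add0r opprK eqxx mul1r => /eqP.
  by rewrite scaler_eq0 mulf_eq0 intr_eq0 i12 /= => /eqP.
have DYY n m : (m - n)%:~R *: D (bM (n + m)) = 0.
  by rewrite -(derZ DD) -lie_bYY DD.2 !DYE lie0l linear0 addr0.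
have DM n : D (bM n) = 0.
  have [->|n0] := eqVneq n 0.
    by have /eqP := DYY 1 (-1); rewrite scaler_eq0 intr_eq0 => /eqP.
  have /eqP := DYY 0 n; rewrite add0r subr0 scaler_eq0 intr_eq0 (negPf n0).
  by move/eqP.
apply/funext => x; elim/b_ind: x => [a x y ex ey||k].
- by rewrite (derD DD) (derZ DD) ex ey scaler0 addr0.
- by rewrite -(scale0r bC) (derZ DD) scale0r.
by case: k => [n|n|n|]; [apply: DL|apply: DYE|apply: DM|apply: DC].
Qed.

(** By the degree, only [M_0], [M_0] and [L_0] in [x] could contribute to the
respective coordinate; but [M_0] is central and [[L_0, Y_0] = 0]. *)
Lemma der_coef_ad x : [/\ der_coef (iM 0) (iL 0) (ad x) = 0,
  der_coef (iM 1) (iL 1) (ad x) = 0 & der_coef (iY 0) (iY 0) (ad x) = 0].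
Proof.
rewrite /der_coef /ad; elim/b_ind: x => [a x y [x1 x2 x3] [y1 y2 y3]||k].
- by rewrite !lieDl !lieZl !linearP /= x1 x2 x3 y1 y2 y3 !mulr0 !addr0.
- by rewrite !lie0l !linear0.
rewrite !lie_b; case: k => [n|n|n|] /=;
  rewrite !(coefE, coef_b, sv_index_eqE) ?(mulr0, addr0, oppr0) //.
- split=> //; have [->|_] := eqVneq n 0; last by rewrite mulr0.
  by rewrite mul0r subr0 mul0r.
- have -> : (1 + n == 1) = (n == 0) by rewrite -subr_eq0 addrAC subrr add0r.
  by rewrite add0r; have [->|_] := eqVneq n 0; rewrite ?mul0r ?mulr0 oppr0.
Qed.

(** [ad L_0] is invertible on the span of the basis vectors of nonzero degree. *)
Lemma deg0_split x : exists y, homogeneous 0 (x - lie y (bL 0)).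
Proof.
elim/b_ind: x => [a x x' [y hy] [y' hy']||k].
- exists (a *: y + y'); rewrite /homogeneous in hy hy' *.
  rewrite lieDl lieZl opprD addrACA -scalerBr lie_linearr hy hy'.
  by rewrite !scale0r scaler0 addr0.
- by exists 0; rewrite /homogeneous lie0l subrr linear0 scaler0.
have [k0|k0] := eqVneq (deg k) 0.
  by exists 0; rewrite lie0l subr0 -k0; apply: homogeneousb.
exists (- (deg k)%:~R^-1 *: b k).
rewrite lie_anti linearZ /= lie_L0b scaleNr opprK scalerA mulVf ?intr_eq0 //.
by rewrite scale1r subrr /homogeneous linear0 scaler0.
Qed.

(** Two inner derivations are subtracted in turn: the first makes [D L_0]
central, the second kills [L_1] without changing the image of [L_0]; nothing
remains by [der_eq0]. *)
Lemma der_coef0_Inn D : Der V D -> der_coef (iM 0) (iL 0) D = 0 ->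
  der_coef (iM 1) (iL 1) D = 0 -> der_coef (iY 0) (iY 0) D = 0 -> Inn V D.
Proof.
move=> DD DM0 DM1 DY0.
have [y hy] := deg0_split (D (bL 0)).
pose E := D - ad y.
have DE : Der V E by apply: der_sub => //; apply: ad_Der.
have [yM0 yM1 yY0] := der_coef_ad y.
have EM0 : der_coef (iM 0) (iL 0) E = 0 by rewrite linearB /= DM0 yM0 subrr.
have EM1 : der_coef (iM 1) (iL 1) E = 0 by rewrite linearB /= DM1 yM1 subrr.
have EY0 : der_coef (iY 0) (iY 0) E = 0 by rewrite linearB /= DY0 yY0 subrr.
have hE0 : homogeneous 0 (E (bL 0)) := hy.
(* In [E [L_0, L_1] = [E L_0, L_1] + [L_0, E L_1]] the degree 1 part of the last
   term equals that of the left side, so that of [[E L_0, L_1]] is zero. *)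
have cE k : deg k = 1 -> coef k (lie (bL 1) (E (bL 0))) = 0.
  move=> k1; have := congr1 (coef k) (DE.2 (bL 0) (bL 1)).
  rewrite lie_L0b scale1r coefE coef_lie_L0 k1 mul1r lie_anti coefE => /eqP.
  by rewrite eq_sym -subr_eq0 addrK oppr_eq0 => /eqP.
have E0 : E (bL 0) = coef iC (E (bL 0)) *: bC.
  have := homogeneousE hE0; rewrite [coef (iM 0) _]EM0 scale0r addr0.
  move: cE; move: (coef _ _) (coef _ _) (coef _ _) => r q p cE e.
  move: (cE (iL 1) erefl) (cE (iY 1) erefl); rewrite {}e {cE}.
  rewrite !linearD !linearZ /= lie_bLL lie_bLY lie_bC.
  rewrite !(coefE, coef_b, sv_index_eqE) !(mulr0, addr0, mulr1, add0r).
  rewrite mulrN1 mul1r mulrN => /eqP + /eqP; rewrite !oppr_eq0.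
  rewrite mulf_eq0 invr_eq0 pnatr_eq0 orbF => /eqP-> /eqP->.
  by rewrite !scale0r !add0r.
have E1 := homogeneous_neq0E (isT : 1 != 0 :> int)
  (der_homogeneous DE E0 (homogeneousb (iL 1))).
rewrite [coef (iM 1) _]EM1 scale0r addr0 in E1.
move: (coef iC _) (coef (iL 1) _) (coef (iY 1) _) E0 E1 => r p q E0 E1.
(* The factor 2 makes up for [[Y_0, L_1] = Y_1 / 2]. *)
pose z := p *: bL 0 + (2%:R * q) *: bY 0.
have zL n : ad z (bL n) = (p * n%:~R) *: bL n + (q * n%:~R) *: bY n.
  rewrite /ad lieDl !lieZl lie_L0b [lie (bY 0) _]lie_anti lie_bLY addr0.
  rewrite sub0r scaleNr opprK !scalerA; by congr (_ + _ *: _); field.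
have [_ _ zY0] := der_coef_ad z.
have Ez : E - ad z = 0.
  apply: (@der_eq0 _ r); first by apply: der_sub => //; apply: ad_Der.
  - by rewrite !fctE E0 zL !mulr0 !scale0r addr0 subr0.
  - by rewrite !fctE E1 zL !mulr1 subrr.
  by rewrite linearB /= EY0 zY0 subrr.
exists (z + y) => //; apply/funext => x.
by rewrite /ad lieDl -/(ad z x) -/(ad y x) -(subr0_eq Ez) /E !fctE subrK.
Qed.

(** ** Outer derivations and the decomposition *)

Lemma Der_basis (D : {linear V -> V}) :
  (forall k l, D (lie (b k) (b l)) = lie (D (b k)) (b l) + lie (b k) (D (b l))) ->
  Der V D.
Proof.
move=> derD; split=> [|x y]; first exact: linearP.
elim/b_ind: x => [a x x' ex ex'||k].
- rewrite [lie (a *: x + x') y]lieDl lieZl 2!linearP /= ex ex'.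
  by rewrite !lieDl !lieZl scalerDr addrACA.
- by rewrite !(lie0l, linear0) addr0.
elim/b_ind: y => [a y y' ey ey'||l //].
- rewrite lie_linearr 2!linearP /= ey ey'.
  by rewrite !lie_linearr scalerDr addrACA.
by rewrite !linear0 addr0.
Qed.

(** The functional equation has the solutions [f = 1] and [f n = n], which
give the first two outer derivations. *)
Lemma Der_LM (f : int -> F) (D : {linear V -> V}) :
  (forall k, D (b k) = if k is iL n then f n *: bM n else 0) ->
  (forall n m, (m - n)%:~R * f (n + m) = m%:~R * f m - n%:~R * f n) ->
  Der V D.
Proof.
move=> Db fP; apply: Der_basis => k l; rewrite !Db lie_b.
case: k l => [n|n|n|] [m|m|m|] /=;
  rewrite ?(linearD, linearN, linearZ, linear0, lieZl, lie0l, Db) /=;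
  rewrite ?lie_b /= ?lie_b /= ?(scaler0, oppr0, addr0, add0r) //.
rewrite scalerA fP [m + n]addrC scalerN -scaleNr !scalerA -scalerDl.
by congr (_ *: _); ring.
Qed.

(** The bracket table is graded by giving [L], [Y], [M], [C] the weights 0, 1, 2,
0; the third outer derivation multiplies by the weight. *)
Lemma Der_weight (w : sv_index -> F) (D : {linear V -> V}) :
  (forall k, D (b k) = w k *: b k) -> (forall n, w (iL n) = 0) ->
  (forall n, w (iY n) = 1) -> (forall n, w (iM n) = 2%:R) -> w iC = 0 -> Der V D.
Proof.
move=> Db wL wY wM wC; apply: Der_basis => k l; rewrite !Db lie_b.
case: k l => [n|n|n|] [m|m|m|] /=;
  rewrite ?(linearD, linearN, linearZ, linear0, lieZl, lie0l) /=;
  rewrite ?lie_b /= ?lie_b /= ?(linearN, linearZ) /= ?Db ?wL ?wY ?wM ?wC;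
  rewrite ?(scale0r, scaler0, oppr0, addr0, add0r, scale1r) //.
- by rewrite scaler_nat mulr2n scalerDr.
- by rewrite scalerN !scalerN !scalerA mulrC.
Qed.

Lemma Der_direct_sum (D1 D2 D3 : {linear V -> V}) :
  (forall k, D1 (b k) = if k is iL n then bM n else 0) ->
  (forall k, D2 (b k) = if k is iL n then n%:~R *: bM n else 0) ->
  (forall k, D3 (b k) = match k with iY n => bY n | iM n => 2%:R *: bM n
                        | iL _ | iC => 0 end) ->
  direct_sum (Der V)
    [:: line (D1 : V -> V); line (D2 : V -> V); line (D3 : V -> V); Inn V].
Proof.
move=> D1b D2b D3b.
have DD1 : Der V D1.
  apply: (@Der_LM (fun=> 1)) => [k|n m]; last by rewrite !mulr1 rmorphB.
  by rewrite D1b; case: k => [n|n|n|]; rewrite ?scale1r.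
have DD2 : Der V D2 by apply: (@Der_LM intr) => // n m; rewrite rmorphB rmorphD; ring.
have DD3 : Der V D3.
  pose w k : F := match k with iY _ => 1 | iM _ => 2%:R | _ => 0 end.
  apply: (@Der_weight w) => // k.
  by rewrite D3b; case: k => [n|n|n|] /=; rewrite ?scale0r ?scale1r.
pose c1 := der_coef (iM 0) (iL 0); pose c2 := der_coef (iM 1) (iL 1).
pose c3 := der_coef (iY 0) (iY 0).
have [D11 D12 D13] : [/\ c1 D1 = 1, c2 D1 = 1 & c3 D1 = 0].
  by rewrite /c1 /c2 /c3 /der_coef !D1b linear0 !coef_b !eqxx.
have [D21 D22 D23] : [/\ c1 D2 = 0, c2 D2 = 1 & c3 D2 = 0].
  rewrite /c1 /c2 /c3 /der_coef !D2b !linearZ linear0 /= !coef_b !eqxx.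
  by rewrite mul0r mul1r.
have [D31 D32 D33] : [/\ c1 D3 = 0, c2 D3 = 0 & c3 D3 = 1].
  by rewrite /c1 /c2 /c3 /der_coef !D3b !linear0 coef_b eqxx.
have cE a1 a2 a3 x (E := a1 *: (D1 : V -> V) + a2 *: (D2 : V -> V)
    + a3 *: (D3 : V -> V) + ad x) :
    [/\ c1 E = a1, c2 E = a1 + a2 & c3 E = a3].
  have [x1 x2 x3] := der_coef_ad x; rewrite /E /c1 /c2 /c3 !linearD !linearZ /=.
  rewrite x1 x2 x3 -/(c1 D1) -/(c1 D2) -/(c1 D3) -/(c2 D1) -/(c2 D2) -/(c2 D3).
  rewrite -/(c3 D1) -/(c3 D2) -/(c3 D3) D11 D12 D13 D21 D22 D23 D31 D32 D33.
  by rewrite !(mulr0, mulr1, addr0, add0r).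
apply: direct_sum4.
- exact: line_subspace.
- exact: line_subspace.
- exact: line_subspace.
- exact: Inn_subspace.
- move=> D; split=> [DD|[_ [_ [_ [_ [[a1 ->] [a2 ->] [a3 ->] [x _ <-] ->]]]]]]; last first.
    rewrite -[a1 *: _]addr0 -!addrA; apply: (Der_subspace.2) => //.
    rewrite add0r; apply: (Der_subspace.2) => //.
    by apply: (Der_subspace.2) => //; apply: ad_Der.
  (* The table of values makes [c1 D], [c2 D - c1 D], [c3 D] the only possible
     coefficients. *)
  pose a2 := c2 D - c1 D; pose D' := c1 D *: (D1 : V -> V) + a2 *: (D2 : V -> V)
    + c3 D *: (D3 : V -> V).
  have DD' : Der V D'.
    rewrite /D' -[X in _ + X]addr0 -!addrA; apply: Der_subspace.2 => //.
    apply: Der_subspace.2 => //; apply: Der_subspace.2 => //.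
    exact: Der_subspace.1.
  have [d1 d2 d3] := cE (c1 D) a2 (c3 D) 0.
  have ad0 : ad (0 : V) = 0 by apply/funext => x; rewrite /ad lie0l.
  rewrite ad0 addr0 -/D' in d1 d2 d3.
  have [x _ xE] : Inn V (D - D').
    apply: der_coef0_Inn; first exact: der_sub.
    + by rewrite [LHS](linearB _ D D' : _ = c1 D - c1 D') d1 subrr.
    + by rewrite [LHS](linearB _ D D' : _ = c2 D - c2 D') d2 [c1 D + _]addrC subrK subrr.
    by rewrite [LHS](linearB _ D D' : _ = c3 D - c3 D') d3 subrr.
  exists (c1 D *: (D1 : V -> V)), (a2 *: (D2 : V -> V)), (c3 D *: (D3 : V -> V)), (ad x).
  split; [by exists (c1 D)|by exists a2|by exists (c3 D)|by exists x|].
  by rewrite -/D' xE addrC subrK.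
move=> _ _ _ _ [a1 ->] [a2 ->] [a3 ->] [x _ <-] E0.
have [/esym c10 c20 /esym c30] := cE a1 a2 a3 x.
rewrite E0 /c1 linear0 in c10; rewrite E0 /c3 linear0 in c30.
rewrite E0 /c2 linear0 c10 add0r in c20.
move: E0; rewrite c10 c30 -c20 !scale0r !add0r => ->.
by split.
Qed.

End SchrodingerVirasoroBasis.

(** * The Schrodinger-Virasoro algebra *)

Section SchrodingerVirasoro.
Variable F : numFieldType.

HB.instance Definition _ :=
  GRing.isLinear.Build F (sv F) (sv F) *:%R (@svD1 F) (@linext_linear _ _ _ _).
HB.instance Definition _ :=
  GRing.isLinear.Build F (sv F) (sv F) *:%R (@svD2 F) (@linext_linear _ _ _ _).
HB.instance Definition _ :=
  GRing.isLinear.Build F (sv F) (sv F) *:%R (@svD3 F) (@linext_linear _ _ _ _).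

Definition sv_coef k (x : sv F) : F := (x : {malg F[sv_index]})@_k.

Lemma sv_coef_linear k : scalar (sv_coef k).
Proof. by move=> a x y; rewrite /sv_coef mcoeffD mcoeffZ. Qed.

HB.instance Definition _ k :=
  GRing.isLinear.Build F (sv F) F *%R (sv_coef k) (sv_coef_linear k).

Lemma Der_sv_direct_sum : direct_sum (Der (sv F))
  [:: line (svD1 : sv F -> sv F); line (svD2 : sv F -> sv F);
      line (svD3 : sv F -> sv F); Inn (sv F)].
Proof.
apply: (@Der_direct_sum F (sv F) (fun k => << k >>) sv_coef).
- exact: sv_lieUU.
- by move=> k l; exact: mcoeffU.
- by move=> x y e; apply/malgP.
- by move=> P PZ P0 PU x; exact: malg_linear_ind.
all: by move=> k; exact: linextU.
Qed.

End SchrodingerVirasoro.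

Theorem theorem2p5 (R : realType) :
  direct_sum (Der (sv R[i]))
    [:: line (svD1 : sv R[i] -> sv R[i]); line (svD2 : sv R[i] -> sv R[i]);
        line (svD3 : sv R[i] -> sv R[i]); Inn (sv R[i])].
Proof. exact: Der_sv_direct_sum. Qed.
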